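(* Let $d\ge 1$. The distance between any two successive roots of a homogeneous trigonometric polynomial of degree $d$ is at most $\frac{d}{d+1}$. That is, if $p_z$ is such a polynomial and $a<b$ are real numbers with $p_z(a)=p_z(b)=0$ and $p_z(t)\neq 0$ for all $t\in(a,b)$, then $b-a\le \frac{d}{d+1}$.
   Context: For $z=(z_1,\dots,z_{2d})\in\mathbb{R}^{2d}\setminus\{0\}$, the homogeneous trigonometric polynomial of degree $d$ with coefficient vector $z$ is the function $p_z\colon\mathbb{R}\to\mathbb{R}$, \[ p_z(t)=\sum_{j=1}^d \bigl(z_{2j-1}\cos(2\pi jt)+z_{2j}\sin(2\pi jt)\bigr).\] (Only $z\ne 0$ is required; the top-frequency coefficients may vanish.) *)

(* Defs.v *)
From mathcomp Require Import all_boot all_order all_algebra.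
From mathcomp Require Import all_classical all_reals all_analysis.

Set Implicit Arguments.
Unset Strict Implicit.
Unset Printing Implicit Defensive.

Import Order.TTheory GRing.Theory Num.Theory.

Local Open Scope ring_scope.

(* Indices are 0-based: for [j : 'I_d], the frequency is [j.+1], and the
   coefficients z_{2(j+1)-1} and z_{2(j+1)} of the 1-based vector z sit at
   positions [2 * j] and [(2 * j).+1]. *)
Lemma cos_idx_proof (d : nat) (j : 'I_d) : (2 * j < 2 * d)%N.
Proof. by rewrite ltn_pmul2l. Qed.

Lemma sin_idx_proof (d : nat) (j : 'I_d) : ((2 * j).+1 < 2 * d)%N.
Proof. by rewrite !mul2n ltn_Sdouble. Qed.

Definition cos_idx (d : nat) (j : 'I_d) : 'I_(2 * d) :=
  Ordinal (cos_idx_proof j).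

Definition sin_idx (d : nat) (j : 'I_d) : 'I_(2 * d) :=
  Ordinal (sin_idx_proof j).

Definition trig_poly (R : realType) (d : nat) (z : 'rV[R]_(2 * d)) (t : R) : R :=
  \sum_(j < d) (z 0 (cos_idx j) * cos (2 * pi * j.+1%:R * t) +
                z 0 (sin_idx j) * sin (2 * pi * j.+1%:R * t)).

(* Main.v *)
Require Import Defs.
From mathcomp Require Import all_boot all_order all_algebra.
From mathcomp Require Import all_classical all_reals all_analysis.
From mathcomp Require Import ring lra.

Import Order.TTheory GRing.Theory Num.Theory.
Import numFieldNormedType.Exports.

(** Sample [p = trig_poly z] at the [d.+1] points [t + k / d.+1], [k <= d].
    A wave of frequency [j] with [1 <= j <= d] turns, from one point to the
    next, by the angle [2 pi j / d.+1], which is not a multiple of [2 pi]; its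
    samples therefore cancel ([sum_cos_equidistributed]), and so the samples of
    [p] sum to zero ([trig_poly_sum_shifts]).  All these points lie in a window
    of length [d / d.+1].  If a root-free interval were longer than that, some
    [t] would put the whole window inside it; there [p] has constant sign by the
    intermediate value theorem ([continuous_neq0_mul_gt0]), so its samples could
    not sum to zero. *)

Local Open Scope ring_scope.

(** Multiplying by [2 * sin (theta / 2)] makes the sum telescope:
    [2 sin (theta / 2) cos u = sin (u + theta / 2) - sin (u - theta / 2)].
    With [theta = 2 pi j / n] the end terms are [j] full turns apart, and
    [0 < j < n] ensures that the multiplier is nonzero. *)
Lemma sum_cos_equidistributed (R : realType) (n j : nat) (x : R) :
  (0 < j < n)%N ->
  \sum_(k < n) cos (x + 2 * pi * j%:R * (k%:R / n%:R)) = 0.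
Proof.
move=> /andP[j_gt0 j_lt_n].
have n_gt0 : 0 < n%:R :> R by rewrite ltr0n; exact: leq_ltn_trans j_lt_n.
have n_neq0 : n%:R != 0 :> R by rewrite gt_eqF.
pose h : R := pi * j%:R / n%:R.
have sin_h : 0 < sin h.
  apply: sin_gt0_pi; rewrite divr_gt0 ?mulr_gt0 ?pi_gt0 ?ltr0n //=.
    by rewrite ltr_pdivrMr // ltr_pM2l ?pi_gt0 // ltr_nat.
  exact: leq_ltn_trans j_lt_n.
pose g (k : nat) : R := sin (x + h *+ 2 * k%:R - h).
have term (k : nat) :
    2 * sin h * cos (x + 2 * pi * j%:R * (k%:R / n%:R)) = g k.+1 - g k.
  have -> : x + 2 * pi * j%:R * (k%:R / n%:R) = x + h *+ 2 * k%:R.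
    by rewrite /h; field.
  have -> : g k.+1 = sin (x + h *+ 2 * k%:R + h).
    by rewrite /g -natr1; congr sin; ring.
  by rewrite /g sinD sinB; ring.
have : 2 * sin h != 0 by rewrite mulf_neq0 ?pnatr_eq0 // gt_eqF.
move=> /mulfI; apply; rewrite mulr0 mulr_sumr.
under eq_bigr do rewrite term.
rewrite -(big_mkord xpredT (fun k => g k.+1 - g k)) telescope_sumr //.
apply/eqP; rewrite subr_eq0; apply/eqP.
have -> : g n = sin (x - h + pi *+ 2 *+ j).
  by rewrite /g /h -[in RHS]mulr_natr; congr sin; field.
by rewrite (periodicn (@sinD2pi R)) /g mulr0 addr0.
Qed.

Lemma sum_sin_equidistributed (R : realType) (n j : nat) (x : R) :
  (0 < j < n)%N ->
  \sum_(k < n) sin (x + 2 * pi * j%:R * (k%:R / n%:R)) = 0.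
Proof.
move=> hj; rewrite -[RHS](@sum_cos_equidistributed R n j (x - pi / 2)) //.
by apply: eq_bigr => k _; rewrite -cosBpihalf addrAC.
Qed.

Lemma trig_poly_sum_shifts (R : realType) (d : nat) (z : 'rV[R]_(2 * d))
    (t : R) : \sum_(k < d.+1) trig_poly z (t + k%:R / d.+1%:R) = 0.
Proof.
rewrite exchange_big /= big1 // => j _; rewrite big_split /= -!mulr_sumr.
have hj : (0 < j.+1 < d.+1)%N by exact: ltn_ord.
under eq_bigr do rewrite mulrDr.
under [X in _ + _ * X]eq_bigr do rewrite mulrDr.
by rewrite sum_cos_equidistributed ?sum_sin_equidistributed // !mulr0 addr0.
Qed.

Lemma trig_poly_continuous (R : realType) (d : nat) (z : 'rV[R]_(2 * d)) :
  continuous (trig_poly z).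
Proof.
move=> t; apply: (@cvg_big _ _ +%R) => [|j _]; first exact: add_continuous.
have arg : {for t, continuous (fun s : R => 2 * pi * j.+1%:R * s)}.
  exact: mulrl_continuous.
apply: cvgD; apply: cvgM; try exact: cvg_cst.
- by apply: continuous_comp arg _; exact: continuous_cos.
- by apply: continuous_comp arg _; exact: continuous_sin.
Qed.

(** The product form of constant sign spares a case split on which sign it is. *)
Lemma continuous_neq0_mul_gt0 (R : realType) (f : R -> R) (a b x y : R) :
  continuous f -> (forall t, a < t < b -> f t != 0) ->
  a < x < b -> a < y < b -> 0 < f x * f y.
Proof.
move=> cf f_neq0.
wlog le_xy : x y / x <= y => [hw|] hx hy.
  have [le|/ltW le] := leP x y; first exact: hw.
  by rewrite mulrC; exact: hw.
rewrite ltNge; apply/negP => fxy_le0.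
have [|c] := IVT (f := f) (v := 0) le_xy (continuous_subspaceT cf).
  rewrite ge_min le_max.
  have := f_neq0 _ hx; have := f_neq0 _ hy.
  case: (ltgtP (f x) 0) => // fx _ _.
    by move: fxy_le0; rewrite nmulr_rle0 // => ->.
  by move: fxy_le0; rewrite pmulr_rle0 // => ->.
rewrite in_itv /= => /andP[xc cy] /eqP; apply/negP/f_neq0.
by case/andP: hx hy => ax _ /andP[_ yb]; rewrite (lt_le_trans ax) // (le_lt_trans cy).
Qed.

Theorem theorem5p12 (R : realType) (d : nat) (hd : (1 <= d)%N)
    (z : 'rV[R]_(2 * d)) (hz : z != 0) (a b : R) (hab : a < b)
    (ha : trig_poly z a = 0) (hb : trig_poly z b = 0)
    (hroot : forall t : R, a < t < b -> trig_poly z t != 0) :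
  b - a <= d%:R / (d.+1)%:R.
Proof.
rewrite leNgt; apply/negP => gap.
(* The slack is split evenly: the window [t, t + d / d.+1] is centred in (a, b). *)
pose t : R := (a + b - d%:R / d.+1%:R) / 2.
have inside (k : 'I_d.+1) : a < t + k%:R / d.+1%:R < b.
  have k_ge0 : 0 <= k%:R / d.+1%:R :> R by rewrite divr_ge0.
  have k_le : k%:R / d.+1%:R <= d%:R / d.+1%:R :> R.
    by rewrite ler_pM2r ?invr_gt0 ?ltr0n // ler_nat -ltnS.
  move: gap k_ge0 k_le; rewrite /t.
  move: (d%:R / _) (k%:R / _) => w s gap s_ge0 s_le.
  by apply/andP; split; lra.
have sample_gt0 (k : 'I_d.+1) :
    0 < trig_poly z (t + (@ord0 d)%:R / d.+1%:R)
        * trig_poly z (t + k%:R / d.+1%:R).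
  by apply: continuous_neq0_mul_gt0 hroot _ _ => //; exact: trig_poly_continuous.
have := congr1 ( *%R (trig_poly z (t + (@ord0 d)%:R / d.+1%:R)))
  (trig_poly_sum_shifts R d z t).
rewrite mulr0 mulr_sumr => /eqP; apply/negP.
rewrite gt_eqF // big_ord_recl ltr_pwDl //.
by apply: sumr_ge0 => k _; exact: ltW.
Qed.
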